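(* Let $m,n,a$ be positive integers with $m\ge 3$. The number of standard Young tableaux of battery shape $[(m^n),a,3]$ is equal to $$f^{(m^n)}\;{}_{[3,5]}F_{[2,4]}\left[\begin{array}{l|l|l} a,\ m,\ -n & -mn,\ 1 & 1\\ a+t,\ m-1,\ -n-1,\ -t,\ -t & -mn+t,\ -t-1,\ -t-1,\ 1 & 1\end{array}\right],$$ where $t$ denotes the first summation index; that is, it is equal to $$f^{(m^n)}\sum_{t=0}^{n}\sum_{v=0}^{t}\frac{(a)_t(m)_t(-n)_t}{(-mn)_t(1)_t\,t!}\cdot\frac{(a+t)_v(m-1)_v(-n-1)_v(-t)_v^2}{(-mn+t)_v(-t-1)_v^2(1)_v\,v!}.$$ Here $f^{(m^n)}$ is the number of standard Young tableaux of rectangular shape $(m^n)$.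
   Context: $(m^n)$ denotes the partition with $n$ parts all equal to $m$ (Young diagram with $n$ rows and $m$ columns; row 1 is the top row). For integers $a\ge 1$, $1\le k\le m$, the battery shape $[(m^n),a,k]$ (of size $mn+a$) is obtained from the Young diagram of $(m^n)$ by adding a column of $a$ cells directly above the top cell of the $k$-th column; in coordinates it consists of the cells $(i,j)$ with $1\le i\le n$, $1\le j\le m$, together with the cells $(0,k),(-1,k),\dots,(1-a,k)$, where the first coordinate is the row (increasing downwards) and the second the column. A standard Young tableau of a shape with $M$ cells is a bijection from the set of cells to $\{1,\dots,M\}$ such that entries increase from left to right in each row and from top to bottom in each column (including the added cells). Pochhammer symbol: $(x)_0=1$, $(x)_s=x(x+1)\cdots(x+s-1)$ for $s\ge1$. Multiple hypergeometric function: for rows $i=0,\dots,N$ with upper parameters $a_{i,1},\dots,a_{i,x_i}$, lower parameters $b_{i,1},\dots,b_{i,y_i}$ and arguments $z_i$ (listed in row $i$ as upper $|$ lower $|$ argument), where $a_{i,j},b_{i,j}$ may depend on the summation indices $m_l$ with $l<i$, $${}_{[x_0,\dots,x_N]}F_{[y_0,\dots,y_N]}[\cdots]=\sum_{m_0\ge 0}\ \sum_{m_1=0}^{m_0}\cdots\sum_{m_N=0}^{m_{N-1}}\ \prod_{i=0}^{N}\frac{\prod_{j=1}^{x_i}(a_{i,j})_{m_i}}{\prod_{j=1}^{y_i}(b_{i,j})_{m_i}}\frac{z_i^{m_i}}{m_i!}.$$ When row $0$ contains an upper parameter $-p$ and a lower parameter $-q$ with integers $0\le p\le q$, the sum over $m_0$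 is truncated to $0\le m_0\le p$. In the claim the indices $m_0,m_1$ are called $t,v$. *)

(* Defs.v *)
From HB Require Import structures.
From mathcomp Require Import all_boot all_order all_algebra.
From mathcomp Require Import finmap.

Set Implicit Arguments.
Unset Strict Implicit.
Unset Printing Implicit Defensive.

Import Order.TTheory GRing.Theory Num.Theory.

Local Open Scope ring_scope.

(* A cell is a pair (row, column) of integers, rows increasing downwards;
   a shape is a finite set of cells. *)
Definition cell : Type := (int * int)%type.

Definition rect_cells (m n : nat) : seq cell :=
  [seq (i%:Z, j%:Z) | i <- iota 1 n, j <- iota 1 m].

Definition rect_shape (m n : nat) : {fset cell} :=
  [fset c in rect_cells m n]%fset.

(* The added cells are (0, k), (-1, k), ..., (1 - a, k).  The definition is
   only meant for 1 <= a and 1 <= k <= m. *)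
Definition battery_shape (m n a k : nat) : {fset cell} :=
  [fset c in rect_cells m n ++ [seq (1 - i%:Z, k%:Z) | i <- iota 1 a]]%fset.

(* The entry of the cell c is (T c).+1, so entries range over 1, ..., #|` S|.
   The first two conditions say that T is a bijection. *)
Definition is_syt (S : {fset cell}) (T : {ffun S -> 'I_#|` S|}) : bool :=
  [&& [forall c, forall d, (T c == T d) ==> (c == d)],
      [forall e, exists c, T c == e],
      [forall c : S, forall d : S,
        ((val c).1 == (val d).1) && ((val c).2 < (val d).2) ==> (T c < T d)%N] &
      [forall c : S, forall d : S,
        ((val c).2 == (val d).2) && ((val c).1 < (val d).1) ==> (T c < T d)%N]].

Definition num_syt (S : {fset cell}) : nat :=
  #|[set T : {ffun S -> 'I_#|` S|} | is_syt T]|.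

Definition poch (x : rat) (s : nat) : rat := \prod_(i < s) (x + i%:R).

Record hyp_row := HypRow {
  hyp_upper : seq rat;
  hyp_lower : seq rat;
  hyp_arg : rat
}.

Definition hyp_term (r : hyp_row) (k : nat) : rat :=
  (\prod_(x <- hyp_upper r) poch x k) / (\prod_(y <- hyp_lower r) poch y k)
  * (hyp_arg r ^+ k / (k`!)%:R).

(* Row i of the multiple hypergeometric function is given as a function of the
   sequence [:: m_0; ...; m_(i-1)] of the preceding summation indices.
   mhyp_rec rows ms b is the iterated sum over the indices of the rows in rows,
   the first of which runs over 0, ..., b and each later one over
   0, ..., (the preceding index); ms lists the indices already chosen. *)
Fixpoint mhyp_rec (rows : seq (seq nat -> hyp_row)) (ms : seq nat) (b : nat)
    : rat :=
  if rows is r :: rows' then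
    \sum_(0 <= k < b.+1) hyp_term (r ms) k * mhyp_rec rows' (rcons ms k) k
  else 1.

(* The terminating series: row 0 has an upper parameter -p and a lower
   parameter -q with p <= q, and its index m_0 is truncated to 0 <= m_0 <= p. *)
Definition mhyp_trunc (p : nat) (rows : seq (seq nat -> hyp_row)) : rat :=
  mhyp_rec rows [::] p.

(* Main.v *)
Require Import Defs.
From HB Require Import structures.
From mathcomp Require Import all_boot all_order all_algebra.
From mathcomp Require Import finmap.
From mathcomp Require Import zify ring.

Set Implicit Arguments.
Unset Strict Implicit.
Unset Printing Implicit Defensive.

Import Order.TTheory GRing.Theory Num.Theory.

Local Open Scope ring_scope.

(** Standard tableaux of a shape are the linear extensions of the poset of its
cells, and they can be counted by repeatedly removing a minimal cell.  Remove
cells from the battery shape in this way.  As long as some of the [a] added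
cells remain, the third column of the rectangle is blocked by them, and so are
the columns to its right; hence the removed part of the rectangle consists of
the top [t] cells of column 1 and the top [v] cells of column 2, with
[v <= t <= n].  When the last added cell goes, what remains is the rectangle
without these [t + v] cells.  Therefore

  number of tableaux = sum over (t, v) of W(t, v) * B(t, v),

where B(t, v) counts the tableaux of the remaining skew shape, and W(t, v)
counts the interleavings of a chain of [a] elements, ending with the chain,
with a two-column tableau of column lengths [t] and [v]:

  W(t, v) = (a)_(t+v) (t + 1 - v) / ((t + 1)! v!).

The indices of the hypergeometric double sum are exactly these [t] and [v].

Turned by 180 degrees, the remaining shape is a Young diagram, so B(t, v) is
given by the formula of Frobenius: for column heights [nu_j], nondecreasing in
[j], and [l_j = nu_j + j], the number of tableaux is
[|nu|! * prod_(i < j) (l_j - l_i) / prod_j l_j!].  Both sides obey the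
recursion that removes one minimal cell ([frobenius_formula]); for the right
side this is the identity

  sum_k l_k prod_(j != k) (1 - 1 / (l_k - l_j)) = sum_k l_k - m (m - 1) / 2,

a consequence of a partial fraction expansion ([partial_fractions],
[sum_weight]).  Dividing the values of the formula at (t, v) and at (0, 0)
gives B(t, v) as a multiple of the number of tableaux of the rectangle
([battery_count_ratio]); multiplied by W(t, v), this multiple is the summand of
the hypergeometric series ([summand_eq]).

The sum over (t, v) is obtained by induction on the number of remaining added
cells ([sum_path_weight_step]), in the manner of a summation by parts. *)

(** * Standard tableaux as linear extensions *)

Definition prec (d c : cell) : bool :=
  ((d.1 == c.1) && (d.2 < c.2)) || ((d.2 == c.2) && (d.1 < c.1)).

(** [prec] is not transitive, but a list without inversions of [prec] has none of
its transitive closure, the order on the cells. *)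
Definition linear_ext (s : seq cell) : bool :=
  pairwise (fun x y => ~~ prec y x) s.

Definition num_ext (s : seq cell) : nat := count linear_ext (permutations s).

Lemma prec_irr c : prec c c = false.
Proof. by rewrite /prec !eqxx !ltxx. Qed.

Lemma num_ext_perm s1 s2 : perm_eq s1 s2 -> num_ext s1 = num_ext s2.
Proof. by move/perm_permutations/permP; apply. Qed.

Lemma eq_index_seq (T : eqType) (s1 s2 : seq T) :
  uniq s1 -> perm_eq s1 s2 -> {in s1, forall x, index x s1 = index x s2} ->
  s1 = s2.
Proof.
case: s1 => [_ /perm_size /esym/size0nil -> //|x0 s] u1 p12 eq12.
apply: (eq_from_nth (x0 := x0)); first exact: perm_size.
move=> i lt_i; have x_s1 := mem_nth x0 lt_i.
rewrite -[in RHS](index_uniq x0 lt_i u1) eq12 // nth_index //.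
by rewrite -(perm_mem p12).
Qed.

(** A tableau is the same as the list of the cells in increasing order of their
entries: the entry of a cell is its index in the list. *)
Lemma num_syt_ext (S : {fset cell}) : num_syt S = num_ext (enum_fset S).
Proof.
rewrite /num_syt /num_ext -size_filter cardE.
set A := [set T | _]; set L := filter _ _.
pose leT (T : {ffun S -> 'I_#|` S|}) := relpre (fun c => val (T c)) leq.
pose so T := sort (leT T) (enum {: S}).
pose g T : seq cell := [seq val c | c <- so T].
have so_perm T : perm_eq (so T) (enum {: S}) by rewrite perm_sort.
have AP T : T \in A -> injective T /\ forall c d : S,
    prec (val c) (val d) -> (T c < T d)%N.
  rewrite inE => /and4P[/forallP inj _ /forallP row /forallP col]; split.
    by move=> c d /eqP cd; apply/eqP; move: (inj c) => /forallP/(_ d)/implyP; apply.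
  move=> c d /orP[] cd.
    by move: (row c) => /forallP/(_ d)/implyP; apply.
  by move: (col c) => /forallP/(_ d)/implyP; apply.
(* Sorted by entries, the cells carry the entries 0, 1, 2, and so on; hence the
   index of a cell in the sorted list is its entry. *)
have so_enum T : T \in A -> map T (so T) = enum 'I_#|` S|.
  move=> /AP[injT _]; apply: (@sorted_eq _ (fun i j : 'I__ => (i <= j)%N)).
  - by move=> ? ? ?; apply: leq_trans.
  - by move=> i j ij; apply/val_inj/eqP; rewrite eqn_leq.
  - by rewrite sorted_map; apply: sort_sorted => c d; apply: leq_total.
  - have := iota_sorted 0 #|` S|; rewrite -val_enum_ord sorted_map.
    by [].
  have um : uniq (map T (so T)).
    by rewrite map_inj_uniq // sort_uniq enum_uniq.
  apply: uniq_perm => //; first exact: enum_uniq.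
  apply: (uniq_min_size um _ _).2 => [i|]; first by rewrite mem_enum.
  rewrite size_enum_ord; apply: eq_leq; apply/esym.
  apply: etrans (size_map _ _) _; apply: etrans (perm_size (so_perm T)) _.
  by rewrite -cardE cardfE.
have idx T c : T \in A -> index (val c) (g T) = T c.
  move=> TA; have [injT _] := AP T TA.
  rewrite /g index_map; last exact: val_inj.
  by rewrite -(index_map injT) so_enum // index_enum_ord.
have gperm T : perm_eq (g T) (enum_fset S).
  apply: (perm_trans (perm_map val (so_perm T))).
  apply: uniq_perm; rewrite ?fset_uniq ?(map_inj_uniq val_inj) ?enum_uniq //.
  move=> x; apply/mapP/idP => [[c _ ->]|xS]; first exact: valP.
  by exists [` xS]%fset; rewrite ?mem_enum.
rewrite -(size_map g); apply: perm_size; apply: uniq_perm.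
- rewrite map_inj_in_uniq ?enum_uniq // => T1 T2.
  rewrite !mem_enum => T1A T2A eqg; apply/ffunP => c.
  by apply: val_inj; rewrite /= -(idx T1) // -(idx T2) // eqg.
- by rewrite filter_uniq ?permutations_uniq.
move=> s; apply/mapP/idP => [[T]|].
  rewrite mem_enum => TA ->; have [injT precT] := AP T TA.
  rewrite mem_filter mem_permutations gperm andbT.
  rewrite /linear_ext /g pairwise_map.
  apply: (sub_pairwise (r := fun c d : S => (T c <= T d)%N)).
    by move=> c d cd /=; apply/negP => /precT; rewrite ltnNge cd.
  rewrite -sorted_pairwise; last by move=> ? ? ?; apply: leq_trans.
  by apply: sort_sorted => c d; apply: leq_total.
rewrite mem_filter mem_permutations => /andP[lin_s perm_s].
(* Conversely, numbering the cells in the order of [s] gives a tableau. *)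
have us : uniq s by rewrite (perm_uniq perm_s) fset_uniq.
have memS (c : S) : val c \in s by rewrite (perm_mem perm_s) (valP c).
have ltS (c : S) : (index (val c) s < #|` S|)%N.
  by rewrite -(perm_size perm_s) index_mem.
pose T : {ffun S -> 'I_#|` S|} := [ffun c => Ordinal (ltS c)].
have injT : injective T.
  move=> c d /(congr1 val); rewrite !ffunE /= => eq_cd.
  exact: val_inj (index_inj (val c) (memS c) (memS d) eq_cd).
have precT (c d : S) : prec (val c) (val d) -> (T c < T d)%N.
  rewrite !ffunE /= => pcd; rewrite ltnNge leq_eqVlt.
  apply/negP => /orP[/eqP eq_dc|lt_dc].
    suff cd : c = d by rewrite cd prec_irr in pcd.
    by apply: injT; rewrite !ffunE; apply: val_inj.
  have /(pairwiseP (val c)) /(_ (index (val d) s) (index (val c) s)) := lin_s.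
  by rewrite !inE !index_mem !memS !nth_index // pcd => /(_ isT isT lt_dc).
have TA : T \in A.
  rewrite inE; apply/and4P; split.
  - by apply/forallP => c; apply/forallP => d; apply/implyP => /eqP/injT ->.
  - have [|T' _ T'K] := inj_card_bij injT; first by rewrite card_ord -cardfE.
    by apply/forallP => e; apply/existsP; exists (T' e); rewrite T'K.
  - apply/forallP => c; apply/forallP => d; apply/implyP => cd.
    by apply: precT; rewrite /prec cd.
  - apply/forallP => c; apply/forallP => d; apply/implyP => cd.
    by apply: precT; rewrite /prec cd orbT.
exists T; first by rewrite mem_enum.
apply: eq_index_seq => // [|x xs].
  by rewrite (perm_trans perm_s) // perm_sym.
have xS : x \in S by rewrite -(perm_mem perm_s).
by rewrite (idx T [` xS]%fset TA) ffunE.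
Qed.

(** The first element of a linear extension is a minimal cell, and the rest is a
linear extension of the remaining cells. *)
Lemma num_ext_rec s : uniq s -> s != [::] ->
  num_ext s = (\sum_(x <- s | all (fun y => ~~ prec y x) s) num_ext (rem x s))%N.
Proof.
move=> us s0; rewrite /num_ext.
have /permP -> : perm_eq (permutations s)
    [seq x :: t | x <- undup s, t <- permutations (rem x s)].
  by apply: permutationsE; rewrite lt0n size_eq0.
rewrite undup_id // -sum1_count big_mkcond.
rewrite big_allpairs_dep [RHS]big_mkcond; apply: eq_big_seq => x xs /=.
have -> : all (fun y => ~~ prec y x) s = all (fun y => ~~ prec y x) (rem x s).
  by rewrite (perm_all _ (perm_to_rem xs)) /= prec_irr.
rewrite -sum1_count [LHS]big_mkcond /= [X in if _ then X else _]big_mkcond /=.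
have E t : t \in permutations (rem x s) ->
    all (fun y => ~~ prec y x) t = all (fun y => ~~ prec y x) (rem x s).
  by rewrite mem_permutations => p; apply: perm_all.
case: ifP => ha; first by apply: eq_big_seq => t /E Et; rewrite Et ha.
by apply: big1_seq => t /= /E Et; rewrite Et ha.
Qed.

(** * Partial fractions and the Vandermonde product *)

(** The factor by which [vdm m x] changes when [x i] is lowered by 1, see
[vdm_decr]. *)
Definition weight (x : nat -> rat) (m i : nat) : rat :=
  \prod_(0 <= j < m | j != i) (1 - (x i - x j)^-1).

Lemma prod_neq_last m (F : nat -> rat) :
  \prod_(0 <= j < m.+1 | j != m) F j = \prod_(0 <= j < m) F j.
Proof.
rewrite big_mkcond big_nat_recr //= eqxx mulr1.
by apply: eq_big_nat => j /andP[_ jm]; rewrite ltn_eqF.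
Qed.

Lemma prod_neq_recr m i (F : nat -> rat) : (i < m)%N ->
  \prod_(0 <= j < m.+1 | j != i) F j = \prod_(0 <= j < m | j != i) F j * F m.
Proof. by move=> im; rewrite big_mkcond big_nat_recr //= -big_mkcond gtn_eqF. Qed.

Lemma weight_recr x m i : (i < m)%N ->
  weight x m.+1 i = weight x m i * (1 - (x i - x m)^-1).
Proof. exact: prod_neq_recr. Qed.

Lemma weight_last x m : weight x m.+1 m = \prod_(0 <= j < m) (1 - (x m - x j)^-1).
Proof. exact: prod_neq_last. Qed.

(** The left side is a rational function of [y] with value 1 at infinity and
simple poles at the [x i], where its residues are [- weight x m i].  Instead of
residues, the proof adds one pole at a time, and uses the expansion for [m]
poles also at [y = x m]. *)
Lemma partial_fractions x m y :
  {in gtn m &, injective x} -> (forall j, (j < m)%N -> y != x j) ->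
  \prod_(0 <= j < m) (1 - (y - x j)^-1) =
    1 - \sum_(0 <= i < m) weight x m i / (y - x i).
Proof.
elim: m y => [|m IH] y injx yx; first by rewrite !big_nil subr0.
have injm : {in gtn m &, injective x}.
  by move=> i j im jm; apply: injx; rewrite inE ltnW.
have xm j : (j < m)%N -> x m != x j.
  move=> jm; apply/eqP => /(injx _ _ (ltnSn m) (ltnW jm)) mj.
  by rewrite mj ltnn in jm.
rewrite big_nat_recr //= IH //; last by move=> j jm; rewrite yx // ltnW.
rewrite big_nat_recr //= weight_last IH //.
have ym : y - x m != 0 by rewrite subr_eq0 yx.
set S1 := \sum_(_ <= _ < _) _; set S2 := \sum_(_ <= _ < _) _.
set S3 := \sum_(_ <= _ < _) _.
suff E : S2 - S3 / (y - x m) = S1 * (1 - (y - x m)^-1).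
  by rewrite -[S2](subrK (S3 / (y - x m))) E; ring.
rewrite /S2 /S3 !mulr_suml -sumrB; apply: eq_big_nat => i /andP[_ im].
rewrite weight_recr //.
have h1 : y - x i != 0 by rewrite subr_eq0 yx // ltnW.
have h2 : x i - x m != 0 by rewrite subr_eq0 eq_sym xm.
have h3 : x m - x i != 0 by rewrite subr_eq0 xm.
by field; rewrite h1 h2 h3 ym.
Qed.

(** The second identity is the one behind the formula of Frobenius.  Passing from
[m] to [m.+1] multiplies [weight x m i] by [1 - (x i - x m)^-1] and adds a term
that [partial_fractions] evaluates at [y = x m]; the change of the second sum
then involves the first sum. *)
Lemma sum_weight x m : {in gtn m &, injective x} ->
  \sum_(0 <= i < m) weight x m i = m%:R /\
  \sum_(0 <= i < m) x i * weight x m i =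
    \sum_(0 <= i < m) x i - 'C(m, 2)%:R.
Proof.
elim: m => [|m IH] injx; first by rewrite !big_nil subr0.
have injm : {in gtn m &, injective x}.
  by move=> i j im jm; apply: injx; rewrite inE ltnW.
have xm j : (j < m)%N -> x m != x j.
  move=> jm; apply/eqP => /(injx _ _ (ltnSn m) (ltnW jm)) mj.
  by rewrite mj ltnn in jm.
have [IH1 IH2] := IH injm.
rewrite !big_nat_recr //= weight_last partial_fractions //.
split.
  rewrite addrC -addrA -[m.+1%:R]natr1 -IH1 [RHS]addrC; congr (_ + _).
  rewrite addrC -sumrB; apply: eq_big_nat => i /andP[_ im].
  rewrite weight_recr //.
  have h2 : x i - x m != 0 by rewrite subr_eq0 eq_sym xm.
  have h3 : x m - x i != 0 by rewrite subr_eq0 xm.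
  by field; rewrite h2 h3.
rewrite binS bin1 natrD -IH1 mulrBr mulr1.
have -> : \sum_(0 <= i < m) x i * weight x m.+1 i =
    \sum_(0 <= i < m) x i * weight x m i -
    \sum_(0 <= i < m) (x i * weight x m i / (x i - x m)).
  rewrite -sumrB; apply: eq_big_nat => i /andP[_ im].
  by rewrite weight_recr //; ring.
have E : \sum_(0 <= i < m) (x i * weight x m i / (x i - x m)) +
   x m * (\sum_(0 <= i < m) weight x m i / (x m - x i)) =
   \sum_(0 <= i < m) weight x m i.
  rewrite mulr_sumr -big_split; apply: eq_big_nat => i /andP[_ im] /=.
  have h2 : x i - x m != 0 by rewrite subr_eq0 eq_sym xm.
  have h3 : x m - x i != 0 by rewrite subr_eq0 xm.
  by field; rewrite h2 h3.
by rewrite -E IH2; ring.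
Qed.

(** The Vandermonde determinant of [x 0, ..., x m.-1]. *)
Definition vdm (m : nat) (x : nat -> rat) : rat :=
  \prod_(0 <= j < m) \prod_(0 <= i < j) (x j - x i).

(** Only the factors that contain [x k] change; stated without division, so that
neither [x] nor [x'] has to be injective. *)
Lemma vdm_update m k (x x' : nat -> rat) : (k < m)%N ->
  (forall j, j != k -> x' j = x j) ->
  vdm m x' * \prod_(0 <= j < m | j != k) (x k - x j) =
  vdm m x * \prod_(0 <= j < m | j != k) (x' k - x j).
Proof.
move=> km xE; elim: m km => // m IH.
rewrite ltnS leq_eqVlt => /predU1P[kE | km].
  rewrite kE in xE *; rewrite /vdm !big_nat_recr //=.
  have xE' j : (j < m)%N -> x' j = x j.
    move=> jm; apply: xE.
    by rewrite ltn_eqF.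
  rewrite !prod_neq_last -!mulrA.
  congr (_ * _).
    apply: eq_big_nat => j /andP[_ jm]; apply: eq_big_nat => i /andP[_ ij].
    by rewrite !xE' // (ltn_trans ij).
  rewrite mulrC; congr (_ * _).
  by apply: eq_big_nat => j /andP[_ jm]; rewrite (xE' j jm).
rewrite /vdm !big_nat_recr //= -!/(vdm _ _).
rewrite !prod_neq_recr // [x' m]xE ?gtn_eqF //.
have Dk (z : nat -> rat) : \prod_(0 <= i < m) (x m - z i) =
    (x m - z k) * \prod_(0 <= i < m | i != k) (x m - z i).
  rewrite (bigD1_seq k) ?iota_uniq ?mem_index_iota //.
rewrite !Dk (eq_bigr (fun i => x m - x i)) => [|i ik]; last by rewrite xE.
have := IH km; set P := \prod_(0 <= i < m | i != k) (x m - x i).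
by move=> E; rewrite mulrACA E; ring.
Qed.

Lemma vdm_decr m k (x x' : nat -> rat) : (k < m)%N ->
  {in gtn m &, injective x} ->
  (forall j, j != k -> x' j = x j) -> x' k = x k - 1 ->
  vdm m x' = vdm m x * weight x m k.
Proof.
move=> km injx xE xk.
have nz : \prod_(0 <= j < m | j != k) (x k - x j) != 0.
  rewrite prodf_seq_neq0; apply/allP => j; rewrite mem_index_iota => /andP[_ jm].
  apply/implyP => jk; rewrite subr_eq0; apply: contra jk => /eqP E.
  by rewrite (injx j k) ?inE //.
apply: (mulIf nz); rewrite (vdm_update km xE) -mulrA; congr (_ * _).
rewrite /weight -big_split /=.
rewrite big_seq_cond [RHS]big_seq_cond; apply: eq_bigr => j.
rewrite mem_index_iota => /andP[/andP[_ jm] jk].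
have nzj : x k - x j != 0.
  by rewrite subr_eq0; apply: contra jk => /eqP E; rewrite (injx j k) ?inE //.
by rewrite xk; field.
Qed.

(** * Bottom-justified columns and the formula of Frobenius *)

(** The cell of the column with index [j] at height [h] above row [n]; columns
and heights are numbered from 0. *)
Definition cell_at (n j h : nat) : cell := (n%:Z - h%:Z, j.+1%:Z).

(** Shapes with [m] columns that all end in row [n], the column with index [j]
having height [nu j].  Rectangles, batteries and everything that is left of
them after removing minimal cells are of this form. *)
Definition cols (m n : nat) (nu : nat -> nat) : seq cell :=
  [seq cell_at n j h | j <- iota 0 m, h <- iota 0 (nu j)].

Lemma cell_at_eq n j h j' h' :
  (cell_at n j h == cell_at n j' h') = (j == j') && (h == h').
Proof. by rewrite /cell_at xpair_eqE; lia. Qed.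

Lemma cols_uniq m n nu : uniq (cols m n nu).
Proof.
apply: allpairs_uniq_dep => [|j _|]; rewrite ?iota_uniq //.
move=> [j h] [j' h'] _ _ /= /eqP; rewrite cell_at_eq => /andP[/eqP-> /eqP->] //.
Qed.

Lemma colsP m n nu c :
  reflect (exists j h, [/\ (j < m)%N, (h < nu j)%N & c = cell_at n j h])
          (c \in cols m n nu).
Proof.
apply: (iffP allpairsPdep) => [[j [h]]|[j [h [jm hj ->]]]].
  by rewrite !mem_iota /= => -[jm hj ->]; exists j, h.
by exists j, h; rewrite !mem_iota.
Qed.

Lemma mem_cols m n nu j h :
  (cell_at n j h \in cols m n nu) = (j < m)%N && (h < nu j)%N.
Proof.
apply/colsP/andP => [[j' [h' [jm hj /eqP]]]|[jm hj]]; last by exists j, h.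
by rewrite cell_at_eq => /andP[/eqP-> /eqP->].
Qed.

(** The top cell of column [j] has no cell to its left. *)
Definition removable (nu : nat -> nat) (j : nat) : bool :=
  (0 < nu j)%N && all (fun i => nu i < nu j)%N (iota 0 j).

Definition decr (nu : nat -> nat) (j i : nat) : nat :=
  if i == j then (nu i).-1 else nu i.

Lemma prec_cell_at n j h j' h' : prec (cell_at n j h) (cell_at n j' h') =
  ((h == h') && (j < j') || (j == j') && (h' < h))%N.
Proof. by rewrite /prec /=; lia. Qed.

(** A minimal cell is the top of its column, and all columns to its left end
below it. *)
Lemma minimal_cols m n nu j h : (j < m)%N -> (h < nu j)%N ->
  all (fun y => ~~ prec y (cell_at n j h)) (cols m n nu) =
  (h == (nu j).-1) && removable nu j.
Proof.
move=> jm hj; rewrite /removable (leq_trans _ hj) //=.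
apply/allP/andP => [minh|[/eqP hE /allP rem]].
  have hE : h = (nu j).-1.
    suff: ~~ (h.+1 < nu j)%N by lia.
    apply/negP => hj'.
    have := minh (cell_at n j h.+1); rewrite mem_cols jm hj' prec_cell_at.
    by rewrite eqxx ltnSn orbT => /(_ isT).
  split; first exact/eqP.
  apply/allP => i; rewrite mem_iota /= => ij.
  rewrite ltnNge; apply/negP => ji; have hi : (h < nu i)%N by lia.
  have := minh (cell_at n i h); rewrite mem_cols prec_cell_at eqxx ij hi.
  by rewrite (ltn_trans ij jm) => /(_ isT).
move=> _ /colsP[i [g [im gi ->]]]; rewrite prec_cell_at.
apply/negP => /orP[/andP[/eqP gh ij]|/andP[/eqP ij hg]]; last by rewrite ij in gi; lia.
by have := rem i; rewrite mem_iota /= => /(_ ij); lia.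
Qed.

Lemma num_ext_cols m n nu : (0 < \sum_(0 <= j < m) nu j)%N ->
  num_ext (cols m n nu) =
  (\sum_(0 <= j < m | removable nu j) num_ext (cols m n (decr nu j)))%N.
Proof.
move=> nu0; rewrite num_ext_rec ?cols_uniq //; last first.
  apply: contraTneq nu0 => cols0; rewrite -leqNgt leqn0 sum_nat_seq_eq0.
  apply/allP => j; rewrite mem_index_iota => /andP[_ jm] /=.
  apply/negPn/negP; rewrite -lt0n => nuj.
  by have := mem_cols m n nu j 0; rewrite cols0 jm nuj.
rewrite big_mkcond big_allpairs_dep /= [RHS]big_mkcond /=.
rewrite /index_iota subn0; apply: eq_big_seq => j; rewrite mem_iota /= => jm.
transitivity (\sum_(0 <= h < nu j | h == (nu j).-1)
   if removable nu j then num_ext (cols m n (decr nu j)) else 0)%N.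
  rewrite [RHS]big_mkcond /index_iota subn0.
  apply: eq_big_seq => h; rewrite mem_iota /= => hj.
  rewrite minimal_cols //; case: eqP => //= hE; case: ifP => // _.
  apply: num_ext_perm; apply: uniq_perm; rewrite ?rem_uniq ?cols_uniq //.
  move=> c; rewrite mem_rem_uniq ?cols_uniq // inE.
  apply/andP/colsP => [[cn /colsP[i [g [im gi cE]]]]|[i [g [im gi ->]]]].
    exists i, g; split=> //; move: cn; rewrite cE cell_at_eq /decr.
    by case: (i =P j) => [ij|_] //=; rewrite -?ij in hE *; lia.
  move: gi; rewrite cell_at_eq mem_cols im /decr.
  by case: (i =P j) => [->|] //=; lia.
case: ifP => [rj|_]; last by rewrite big1.
rewrite -big_filter.
have -> : [seq h <- index_iota 0 (nu j) | h == (nu j).-1] = [:: (nu j).-1].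
  rewrite -(filter_pred1_uniq (s := index_iota 0 (nu j)) (x := (nu j).-1)) ?iota_uniq //.
  by rewrite mem_index_iota; case/andP: rj; lia.
by rewrite big_seq1.
Qed.

Lemma sum_decr m nu k : (k < m)%N -> (0 < nu k)%N ->
  (\sum_(0 <= j < m) nu j = (\sum_(0 <= j < m) decr nu k j).+1)%N.
Proof.
move=> km nuk; rewrite !(bigD1_seq k) ?iota_uniq ?mem_index_iota //=.
rewrite {1}/decr eqxx -addSn prednK //; congr addn.
by apply: eq_bigr => j jk; rewrite /decr (negPf jk).
Qed.

Definition shifted (nu : nat -> nat) (j : nat) : rat := (nu j + j)%:R.

Definition ndecr_cols (m : nat) (nu : nat -> nat) : Prop :=
  forall i j, (i <= j < m)%N -> (nu i <= nu j)%N.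

(** Induction on the number of cells.  Removing a cell of column [k] takes the
factor [shifted nu k] out of the product of factorials and multiplies the
Vandermonde product by [weight], so the recursion becomes [sum_weight].  Columns
that are not removable may be included in the sum, since their terms vanish. *)
Lemma frobenius_formula m n nu : ndecr_cols m nu ->
  (num_ext (cols m n nu))%:R * \prod_(0 <= j < m) ((nu j + j)`!)%:R =
  ((\sum_(0 <= j < m) nu j)`!)%:R * vdm m (shifted nu).
Proof.
move: {2}(\sum_(0 <= j < m) nu j)%N (erefl (\sum_(0 <= j < m) nu j)%N) => s.
elim: s nu => [|s IH] nu sE mono.
  rewrite sE mul1r.
  have nu0 j : (j < m)%N -> nu j = 0%N.
    move=> jm; move/eqP: sE; rewrite sum_nat_seq_eq0 => /allP/(_ j).
    by rewrite mem_index_iota => /(_ jm)/eqP.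
  have -> : cols m n nu = [::].
    apply: size0nil; apply/eqP; rewrite size_eq0; apply: contraT.
    case E : (cols m n nu) => [//|c t] _; have : c \in cols m n nu by rewrite E mem_head.
    by case/colsP=> j [h [/nu0 ->]].
  rewrite /num_ext /= mul1r /vdm; apply: eq_big_nat => j /andP[_ jm].
  rewrite nu0 // add0n.
  transitivity (\prod_(0 <= i < j) (i.+1%:R : rat)).
    by rewrite -natr_prod fact_prod big_add1.
  rewrite big_nat_rev /= add0n; apply: eq_big_nat => i /andP[_ ij].
  rewrite /shifted (nu0 j jm) (nu0 i (ltn_trans ij jm)) !add0n.
  by apply/esym/eqP; rewrite subr_eq -natrD eqr_nat; lia.
have inj : {in gtn m &, injective (shifted nu)}.
  move=> i j; rewrite !inE => im jm /eqP; rewrite eqr_nat => /eqP.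
  case: (ltngtP i j) => // ij; last by have := mono j i; lia.
  by have := mono i j; lia.
rewrite num_ext_cols ?sE // natr_sum mulr_suml.
transitivity (\sum_(0 <= k < m)
    s`!%:R * vdm m (shifted nu) * (shifted nu k * weight (shifted nu) m k)).
  rewrite big_mkcond; apply: eq_big_nat => k /andP[_ km].
  case: ifP => [rk|/negbT nrk].
    have nuk : (0 < nu k)%N by case/andP: rk.
    have sE' := sum_decr km nuk; rewrite sE in sE'; case: sE' => sE'.
    have mono' : ndecr_cols m (decr nu k).
      move=> i j ij; have := mono i j ij; rewrite /decr.
      case: (i =P k) => [->|ik]; case: (j =P k) => [jk|jk]; try lia.
      case/andP: rk => _ /allP/(_ i); rewrite mem_iota jk /=; lia.
    have factE : \prod_(0 <= j < m) ((nu j + j)`!)%:R =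
        shifted nu k * \prod_(0 <= j < m) ((decr nu k j + j)`!)%:R.
      rewrite !(bigD1_seq k) ?iota_uniq ?mem_index_iota //= {1}/decr eqxx.
      rewrite mulrA /shifted -natrM.
      have -> : (nu k + k = ((nu k).-1 + k).+1)%N by lia.
      rewrite -factS; congr (_ * _).
      by apply: eq_bigr => j jk; rewrite /decr (negPf jk).
    rewrite factE mulrCA IH // -sE'.
    rewrite (@vdm_decr m k (shifted nu)) //.
    - by ring.
    - by move=> j jk; rewrite /shifted /decr (negPf jk).
    - rewrite /shifted /decr eqxx; apply/esym/eqP.
      by rewrite subr_eq natr1 eqr_nat; lia.
  (* A column that is not removable is either column 0, empty, with
     [shifted nu 0 = 0], or as high as its left neighbour, whose shifted height
     is then smaller by 1, so that a factor of the weight vanishes. *)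
  case: k => [|k] in km nrk *.
    by move: nrk; rewrite /removable andbT lt0n negbK /shifted => /eqP->; rewrite addn0 mul0r mulr0.
  have nukE : nu k = nu k.+1.
    apply/eqP; rewrite eqn_leq mono ?leqnSn //=.
    move: nrk; rewrite negb_and => /orP[|/allPn[i]]; first by lia.
    by rewrite mem_iota /= => ik; have := mono i k; lia.
  suff -> : weight (shifted nu) m k.+1 = 0 by rewrite !mulr0.
  apply/eqP; rewrite /weight prodf_seq_eq0; apply/hasP; exists k.
    by rewrite mem_index_iota; lia.
  rewrite ltn_eqF //= /shifted nukE addnS -natr1 addrAC subrr add0r invr1.
  by rewrite subrr.
rewrite -mulr_sumr (sum_weight inj).2.
have -> : \sum_(0 <= i < m) shifted nu i - 'C(m, 2)%:R = s.+1%:R.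
  rewrite /shifted -natr_sum big_split /= sE bin2_sum natrD; ring.
by rewrite factS natrM; ring.
Qed.

(** * The shapes left over by a battery *)

Lemma eq_cols m n nu nu' : (forall j, (j < m)%N -> nu j = nu' j) ->
  cols m n nu = cols m n nu'.
Proof.
move=> eq_nu; rewrite /cols; congr flatten.
by apply/eq_in_map => j; rewrite mem_iota /= => /eq_nu ->.
Qed.

(** What remains of a battery with [b] added cells when the top [t] and [v] cells
of the first two columns are removed.  The added cells simply make the third
column higher. *)
Definition battery_heights (n t v b j : nat) : nat :=
  match j with 0 => n - t | 1 => n - v | 2 => n + b | _ => n end.

Lemma mem_rect_cells m n (x y : int) :
  (x, y) \in rect_cells m n <-> (1 <= x <= n%:Z) /\ (1 <= y <= m%:Z).
Proof.
split=> [/allpairsP[[i j] /= []]|[hx hy]].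
  by rewrite !mem_iota => ? ? [-> ->]; lia.
apply/allpairsP; exists (`|x|%N, `|y|%N) => /=.
by rewrite !mem_iota; split; first lia; first lia; congr (_, _); lia.
Qed.

Lemma battery_heights_le n b j : (battery_heights n 0 0 b j <= n + b)%N.
Proof. by rewrite /battery_heights; case: j => [|[|[|j]]]; lia. Qed.

Lemma battery_heights_ge n b j : (n <= battery_heights n 0 0 b j)%N.
Proof. by rewrite /battery_heights; case: j => [|[|[|j]]]; lia. Qed.

Lemma battery_heights_gt n b j : (n < battery_heights n 0 0 b j)%N -> j = 2%N.
Proof. by rewrite /battery_heights; case: j => [|[|[|j]]]; lia. Qed.

Lemma rect_cols m n :
  num_syt (rect_shape m n) = num_ext (cols m n (battery_heights n 0 0 0)).
Proof.
rewrite num_syt_ext; apply: num_ext_perm; apply: uniq_perm.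
- exact: fset_uniq.
- exact: cols_uniq.
move=> [x y]; rewrite in_fset /=; apply/idP/colsP.
  move/mem_rect_cells => [hx hy]; exists `|y - 1|%N, `|n%:Z - x|%N; split.
  - by lia.
  - by apply: leq_trans (battery_heights_ge _ _ _); lia.
  - by rewrite /cell_at; congr (_, _); lia.
move=> [j [h [jm hj ->]]]; apply/mem_rect_cells.
by have := battery_heights_le n 0 j; lia.
Qed.

Lemma battery_cols m n a : (3 <= m)%N ->
  num_syt (battery_shape m n a 3) = num_ext (cols m n (battery_heights n 0 0 a)).
Proof.
move=> m3; rewrite num_syt_ext; apply: num_ext_perm; apply: uniq_perm.
- exact: fset_uniq.
- exact: cols_uniq.
move=> [x y]; rewrite in_fset /= mem_cat; apply/orP/colsP.
  case=> [/mem_rect_cells [hx hy]|/mapP[i]].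
    exists `|y - 1|%N, `|n%:Z - x|%N; split.
    + by lia.
    + by apply: leq_trans (battery_heights_ge _ _ _); lia.
    + by rewrite /cell_at; congr (_, _); lia.
  rewrite mem_iota => ia [-> ->]; exists 2%N, (n + i).-1; split=> //.
    by rewrite /battery_heights; lia.
  by rewrite /cell_at; congr (_, _); lia.
move=> [j [h [jm hj ->]]]; case: (ltnP h n) => hn.
  by left; apply/mem_rect_cells; lia.
right; apply/mapP; exists (h - n).+1; rewrite ?mem_iota.
  by have := battery_heights_le n a j; lia.
by rewrite (battery_heights_gt (leq_ltn_trans hn hj)) /cell_at; congr (_, _); lia.
Qed.

(** Extended by 0 outside of the triangle [v <= t <= n], so that the recursion
needs no case distinction and sums can be shifted freely. *)
Definition battery_count (m n b t v : nat) : rat :=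
  if (v <= t <= n)%N then (num_ext (cols m n (battery_heights n t v b)))%:R
  else 0.

Lemma battery_count0 m n b t v : (t < v)%N -> battery_count m n b t v = 0.
Proof. by move=> tv; rewrite /battery_count [(v <= t)%N]leqNgt tv. Qed.

(** While an added cell remains, only the tops of the first three columns can be
minimal: the columns further right are lower than the third. *)
Lemma battery_count_rec m n b t v : (3 <= m)%N -> (v <= t <= n)%N ->
  battery_count m n b.+1 t v = battery_count m n b.+1 t.+1 v +
    battery_count m n b.+1 t v.+1 + battery_count m n b t v.
Proof.
move=> m3 vtn; rewrite /battery_count vtn.
case: m m3 => [|[|[|m]]] // _.
have H nu nu' : (forall j, nu j = nu' j) ->
    num_ext (cols m.+3 n nu) = num_ext (cols m.+3 n nu').
  by move=> E; congr num_ext; apply: eq_cols.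
rewrite num_ext_cols; last by rewrite 3?big_nat_recl //=; lia.
rewrite big_mkcond 3?big_nat_recl //= big1_seq => [|j _]; last first.
  case: ifP => // /andP[_ /allP/(_ 2%N)].
  by rewrite mem_iota /battery_heights /=; lia.
rewrite addn0 !natrD addrA; congr (_ + _ + _).
- rewrite /removable /= andbT; case: ltnP => nt; case: ifP => // h; try lia.
  by congr (_%:R); apply: H => -[|j]; rewrite /decr /battery_heights /=; lia.
- rewrite /removable /= andbT; case: ifP => h1; case: ifP => h2 //; try lia.
  by congr (_%:R); apply: H => -[|[|j]]; rewrite /decr /battery_heights /=; lia.
- rewrite /removable /= andbT; case: ifP => h1; last by lia.
  by congr (_%:R); apply: H => -[|[|[|j]]]; rewrite /decr /battery_heights /=; lia.
Qed.

(** * Pochhammer symbols *)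

Lemma pochS x s : poch x s.+1 = poch x s * (x + s%:R).
Proof. by rewrite /poch big_ord_recr. Qed.

Lemma poch0 x : poch x 0 = 1.
Proof. by rewrite /poch big_ord0. Qed.

Lemma pochSl x s : poch x s.+1 = x * poch (x + 1) s.
Proof.
rewrite /poch big_ord_recl addr0; congr (_ * _).
by apply: eq_bigr => i _; rewrite lift0 -natr1 addrA addrAC.
Qed.

Lemma pochD x s r : poch x (s + r) = poch x s * poch (x + s%:R) r.
Proof.
elim: r => [|r IH]; first by rewrite addn0 poch0 mulr1.
by rewrite addnS !pochS IH natrD; ring.
Qed.

Lemma poch1 s : poch 1 s = s`!%:R.
Proof.
elim: s => [|s IH]; first by rewrite poch0.
by rewrite pochS IH factS natrM -natr1; ring.
Qed.

(** [(- K)_s] is up to sign the falling factorial [K! / (K - s)!]. *)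
Lemma poch_neg K s : (s <= K)%N ->
  poch (- K%:R) s * (K - s)`!%:R = (-1) ^+ s * K`!%:R.
Proof.
elim: s => [|s IH] sK; first by rewrite poch0 subn0 expr0.
have -> : poch (- K%:R) s.+1 * (K - s.+1)`!%:R =
    - (poch (- K%:R) s * (K - s)`!%:R).
  have -> : (K - s = (K - s.+1).+1)%N by lia.
  rewrite factS natrM pochS.
  have -> : (K - s.+1).+1%:R = K%:R - s%:R :> rat.
    by apply/esym/eqP; rewrite subr_eq -natrD eqr_nat; lia.
  ring.
by rewrite IH ?(ltnW sK) // exprS; ring.
Qed.

Lemma fact_neq0 s : s`!%:R != 0 :> rat.
Proof. by rewrite pnatr_eq0 -lt0n fact_gt0. Qed.

(** * Summation over the interleavings *)

(** The number of shuffles of a two-column tableau of column lengths [t] and [v]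
with a chain of [c] elements, the last of which is the greatest element: the
product of ['C(t + v + c - 1, t + v)] and the number
[(t + v)! (t + 1 - v) / ((t + 1)! v!)] of such tableaux.  For [v = t + 1] the
formula gives 0. *)
Definition path_weight (c : rat) (t v : nat) : rat :=
  poch c (t + v) * (t.+1%:R - v%:R) / ((t.+1)`!%:R * v`!%:R).

(** Dual to [battery_count_rec]: the last step before reaching [(t, v)] is in the
chain or in one of the two columns. *)
Lemma path_weight_rec c t v : (v <= t)%N ->
  path_weight (c + 1) t v = path_weight c t v +
    (if t is t'.+1 then path_weight (c + 1) t' v else 0) +
    (if v is v'.+1 then path_weight (c + 1) t v' else 0).
Proof.
have S0 (k : nat) : k%:R + 1 != 0 :> rat by rewrite natr1 pnatr_eq0.
have S1 (k : nat) : k%:R + 1 + 1 != 0 :> rat by rewrite !natr1 pnatr_eq0.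
case: t => [|t]; case: v => [|v] // vt; rewrite /path_weight.
- by rewrite !poch0 !addr0.
- rewrite !addn0 addr0 pochS pochSl !factS !natrM -!natr1.
  field; rewrite !S0 S1 !fact_neq0 //.
rewrite !addSn !addnS (pochS _ (t + v).+1) (pochSl c).
rewrite !factS !natrM -!natr1 natrD.
field; rewrite !S0 S1 !fact_neq0 //.
Qed.

(** Summation by parts: [path_weight_rec] replaces the weight for [c] by
differences of the weight for [c + 1], and after shifting the sums
[battery_count_rec] collects the differences of the counts into the count with
one added cell less. *)
Lemma sum_path_weight_step m n b c : (3 <= m)%N ->
  \sum_(0 <= t < n.+1) \sum_(0 <= v < n.+1)
    path_weight c t v * battery_count m n b.+1 t v =
  \sum_(0 <= t < n.+1) \sum_(0 <= v < n.+1)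
    path_weight (c + 1) t v * battery_count m n b t v.
Proof.
move=> m3; set B := battery_count m n b.+1; set W := path_weight (c + 1).
have Bt0 v : B n.+1 v = 0 by rewrite /B /battery_count ltnn andbF.
have Bv0 t v : (t < v)%N -> B t v = 0 by apply: battery_count0.
pose Wt t v := if t is t'.+1 then W t' v else 0.
pose Wv t v := if v is v'.+1 then W t v' else 0.
have shift_t : \sum_(0 <= t < n.+1) \sum_(0 <= v < n.+1) Wt t v * B t v =
    \sum_(0 <= t < n.+1) \sum_(0 <= v < n.+1) W t v * B t.+1 v.
  rewrite big_nat_recl // [RHS]big_nat_recr //= addrC; congr (_ + _).
  rewrite !big1_seq // => v _; first by rewrite Bt0 mulr0.
  by rewrite mul0r.
have shift_v : \sum_(0 <= t < n.+1) \sum_(0 <= v < n.+1) Wv t v * B t v =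
    \sum_(0 <= t < n.+1) \sum_(0 <= v < n.+1) W t v * B t v.+1.
  apply: eq_big_nat => t /andP[_ tn].
  rewrite big_nat_recl // [RHS]big_nat_recr //= addrC; congr (_ + _).
  by rewrite (Bv0 t n.+1) // mulr0 mul0r.
transitivity (\sum_(0 <= t < n.+1) \sum_(0 <= v < n.+1)
   (W t v * B t v - Wt t v * B t v - Wv t v * B t v)).
  apply: eq_big_nat => t _; apply: eq_big_nat => v _.
  case: (leqP v t) => vt; last by rewrite Bv0 // !mulr0 !subr0.
  by rewrite /W path_weight_rec // -/(Wt t v) -/(Wv t v); ring.
under eq_bigr do rewrite !sumrB.
rewrite !sumrB shift_t shift_v -!sumrB.
apply: eq_big_nat => t /andP[_ tn]; rewrite -!sumrB.
apply: eq_big_nat => v _; case: (leqP v t) => vt.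
  by rewrite {1}/B battery_count_rec -/B ?vt //; ring.
rewrite (battery_count0 m n b vt) (Bv0 _ _ vt) (Bv0 t v.+1 (leqW vt)) !mulr0.
(* Just outside of the triangle, at [v = t + 1], the count at [(t + 1, v)] does
   not vanish, but the weight does. *)
move: vt; rewrite leq_eqVlt => /predU1P[<-|vt]; last by rewrite Bv0 // mulr0 !subr0.
by rewrite /W /path_weight subrr mulr0 !mul0r !subr0.
Qed.

(** For [c = 0] the weight is 1 at [(0, 0)] and 0 elsewhere; each of the [a] steps
trades one added cell for an increase of [c] by 1. *)
Lemma battery_count_sum m n a : (3 <= m)%N ->
  battery_count m n a 0 0 =
  \sum_(0 <= t < n.+1) \sum_(0 <= v < n.+1)
    path_weight a%:R t v * battery_count m n 0 t v.
Proof.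
move=> m3; have step b c : \sum_(0 <= t < n.+1) \sum_(0 <= v < n.+1)
    path_weight c t v * battery_count m n b t v =
  \sum_(0 <= t < n.+1) \sum_(0 <= v < n.+1)
    path_weight (c + b%:R) t v * battery_count m n 0 t v.
  elim: b c => [|b IH] c; first by rewrite addr0.
  by rewrite sum_path_weight_step // IH -natr1 -addrA [1 + _]addrC.
rewrite -[a%:R in RHS]add0r -step.
have W0 t v : (0 < t + v)%N -> path_weight 0 t v = 0.
  by rewrite /path_weight; case: (t + v)%N => // s _; rewrite pochSl !mul0r.
rewrite !big_nat_recl // !big1_seq => [|t _|v _].
- have -> : path_weight 0 0 0 = 1.
    by rewrite /path_weight poch0 mul1r subr0.
  by rewrite mul1r !addr0.
- by rewrite big1_seq // => v _; rewrite W0 ?mul0r // addSn.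
- by rewrite W0 ?mul0r.
Qed.

(** * The number of tableaux of the remaining shape *)

(** Lowering the first two columns by [t] and [v] changes the shifted heights
[n] and [n + 1] into [n - t] and [n + 1 - v].  Each column [j >= 2] then
contributes the factor [(j + t) (j - 1 + v) / (j (j - 1))], and the products of
these telescope to Pochhammer symbols. *)
Lemma vdm_battery m n t v : (v <= t <= n)%N ->
  vdm m.+2 (shifted (battery_heights n t v 0)) =
  vdm m.+2 (shifted (battery_heights n 0 0 0)) *
    ((t.+1%:R - v%:R) * (poch m.+2%:R t / (t.+1)`!%:R) *
     (poch m.+1%:R v / v`!%:R)).
Proof.
move=> /andP[vt tn].
have sE u w : (w <= n)%N -> (u <= n)%N ->
    (shifted (battery_heights n u w 0) 0 = n%:R - u%:R) *
    (shifted (battery_heights n u w 0) 1 = n.+1%:R - w%:R).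
  move=> wn un; rewrite /shifted /=.
  by split; apply/esym/eqP; rewrite subr_eq -natrD eqr_nat; lia.
elim: m => [|m IH].
  have two s : poch 2%:R s = s.+1`!%:R.
    by rewrite -poch1 pochSl mul1r.
  rewrite /vdm !big_nat_recr //= !big_nil !mul1r !sE ?(leq_trans vt) //.
  rewrite two poch1 !divff ?fact_neq0 // -!natr1; ring.
have S0 (k : nat) : k%:R + 1 != 0 :> rat by rewrite natr1 pnatr_eq0.
have S1 (k : nat) : k%:R + 1 + 1 != 0 :> rat by rewrite !natr1 pnatr_eq0.
have pochS1 k s : poch k.+2%:R s = poch k.+1%:R s * (k.+1%:R + s%:R) / k.+1%:R.
  by rewrite -pochS pochSl natr1 mulrAC divff ?mul1r // pnatr_eq0.
rewrite {1}/vdm big_nat_recr //= -/(vdm _ _) IH.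
rewrite [in RHS]/vdm [in RHS]big_nat_recr //= -/(vdm _ _).
rewrite ![\prod_(0 <= i < m.+2) _]big_nat_recl // ![\prod_(0 <= i < m.+1) _]big_nat_recl //.
rewrite !sE ?(leq_trans vt) // (pochS1 m.+1 t) (pochS1 m v).
have tail u w j : shifted (battery_heights n u w 0) j.+2 = n%:R + j.+2%:R.
  by rewrite /shifted -natrD; case: j => //=; rewrite addn0.
have -> u w : \prod_(0 <= i < m) (shifted (battery_heights n u w 0) m.+2 -
    shifted (battery_heights n u w 0) i.+2) = \prod_(0 <= i < m) (m%:R - i%:R).
  by apply: eq_bigr => i _; rewrite !tail -!natr1; ring.
rewrite !tail -!natr1; field.
by rewrite ?S0 ?S1 ?fact_neq0.
Qed.

Lemma battery_count_ratio m n t v : (3 <= m)%N -> (v <= t <= n)%N ->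
  battery_count m n 0 t v = (num_syt (rect_shape m n))%:R *
    ((m * n - (t + v))`!%:R / (m * n)`!%:R *
     (n`!%:R * n.+1`!%:R / ((n - t)`!%:R * (n.+1 - v)`!%:R)) *
     ((t.+1%:R - v%:R) * (poch m%:R t / (t.+1)`!%:R) *
     (poch (m%:R - 1) v / v`!%:R))).
Proof.
move=> m3 vtn; rewrite /battery_count vtn rect_cols.
case: m m3 => [|[|m]] // m3.
have mono u w : (w <= u <= n)%N -> ndecr_cols m.+2 (battery_heights n u w 0).
  by move=> wu [|[|[|i]]] [|[|[|j]]]; rewrite /battery_heights; lia.
have := @frobenius_formula _ n _ (mono t v vtn).
have := @frobenius_formula _ n _ (mono 0 0 isT).
rewrite (vdm_battery _ vtn).
have sumE u w : (w <= u <= n)%N ->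
    (\sum_(0 <= j < m.+2) battery_heights n u w 0 j = m.+2 * n - (u + w))%N.
  move=> wu; rewrite !big_nat_recl //=.
  rewrite (eq_bigr (fun=> n)) ?sum_nat_const_nat; last first.
    by move=> [|i] _; rewrite /= ?addn0.
  by rewrite subn0; lia.
rewrite !sumE // !addn0 subn0.
have prodE u w : (w <= u <= n)%N ->
    \prod_(0 <= j < m.+2) ((battery_heights n u w 0 j + j)`!%:R : rat) =
    (n - u)`!%:R * (n.+1 - w)`!%:R * \prod_(0 <= j < m) (n + j.+2)`!%:R.
  move=> wu; rewrite !big_nat_recl //= addn0 mulrA addn1 subSn; last by lia.
  congr (_ * _); apply: eq_bigr => -[|j] _ //=; by rewrite addn0.
rewrite !prodE // !subn0.
set P := \prod_(0 <= j < m) _.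
have P0 : P != 0.
  by rewrite prodf_seq_neq0; apply/allP => j _; rewrite fact_neq0.
set V := vdm _ _; move=> E0 E1.
have -> : m.+2%:R - 1 = m.+1%:R :> rat by rewrite -natr1 addrK.
have nz := fact_neq0.
apply: (mulIf (mulf_neq0 (mulf_neq0 (nz (n - t)%N) (nz (n.+1 - v)%N)) P0)).
rewrite E1.
have -> : V = (num_ext (cols m.+2 n (battery_heights n 0 0 0)))%:R *
    (n`!%:R * n.+1`!%:R * P) / (m.+2 * n)`!%:R.
  by rewrite E0 mulrAC divff ?mul1r.
by field; rewrite !nz.
Qed.

(** The signs of the four Pochhammer symbols with negative arguments [- N],
[- N - 1], [- (M * N)] and [- (M * N) + t] cancel, and the squared quotient of
[poch (- t) v] by [poch (- t - 1) v] is [((t + 1 - v) / (t + 1)) ^ 2], which is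
the product of the dimension factors of both shapes. *)
Lemma summand_eq m n a t v : (3 <= m)%N -> (v <= t <= n)%N ->
  let M : rat := m%:R in let N : rat := n%:R in let A : rat := a%:R in
  path_weight A t v * battery_count m n 0 t v =
  (num_syt (rect_shape m n))%:R *
      (poch A t * poch M t * poch (- N) t
         / (poch (- (M * N)) t * poch 1 t * (t`!)%:R)
       * (poch (A + t%:R) v * poch (M - 1) v * poch (- N - 1) v
            * poch (- t%:R) v ^+ 2
          / (poch (- (M * N) + t%:R) v * poch (- t%:R - 1) v ^+ 2
             * poch 1 v * (v`!)%:R))).
Proof.
move=> m3 vtn M N A; have /andP[vt tn] := vtn; have nz := fact_neq0.
rewrite battery_count_ratio // mulrCA; congr (_ * _).
have t0 : t.+1%:R != 0 :> rat by rewrite pnatr_eq0.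
have tv0 : t.+1%:R - v%:R != 0 :> rat by rewrite subr_eq0 eqr_nat; lia.
have sgn0 k : (-1) ^+ k != 0 :> rat by rewrite expf_neq0 // oppr_eq0 oner_eq0.
have pochN K s : (s <= K)%N ->
    poch (- K%:R) s = (-1) ^+ s * K`!%:R / (K - s)`!%:R.
  by move=> sK; rewrite -poch_neg // mulfK.
have stN : (t + v <= m * n)%N.
  by apply: leq_trans (leq_mul m3 tn); lia.
have mnE : poch (- (M * N)) t * poch (- (M * N) + t%:R) v =
    (-1) ^+ (t + v) * (m * n)`!%:R / (m * n - (t + v))`!%:R.
  by rewrite -pochD -natrM pochN.
have tN : poch (- t%:R) v = poch (- t%:R - 1) v * (t.+1%:R - v%:R) / t.+1%:R.
  have := pochS (- t%:R - 1) v; rewrite pochSl subrK => E.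
  apply: (mulIf t0); rewrite divfK //; apply: oppr_inj.
  rewrite -mulrN -natr1 (_ : _ * - _ = (- t%:R - 1) * poch (- t%:R) v); last by ring.
  by rewrite E; ring.
have p0 : poch (- t%:R - 1) v != 0.
  rewrite /poch; apply/prodf_neq0 => i _.
  rewrite -opprD natr1 addrC subr_eq0 eqr_nat.
  by have := ltn_ord i; lia.
have nE : poch (- N - 1) v = (-1) ^+ v * n.+1`!%:R / (n.+1 - v)`!%:R.
  by rewrite -opprD natr1 pochN //; lia.
rewrite tN nE [poch (- N) t]pochN // !poch1.
rewrite /path_weight pochD.
have q0 : poch (- (M * N)) t * poch (- (M * N) + t%:R) v != 0.
  by rewrite mnE !mulf_neq0 ?invr_neq0.
have [q1 q2] : poch (- (M * N)) t != 0 /\ poch (- (M * N) + t%:R) v != 0.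
  by apply/andP; rewrite -negb_or -mulf_eq0.
have -> : (m * n - (t + v))`!%:R / (m * n)`!%:R =
    (-1) ^+ t * (-1) ^+ v / (poch (- (M * N)) t * poch (- (M * N) + t%:R) v).
  by rewrite mnE exprD; field; rewrite !nz !sgn0.
rewrite factS natrM.
by field; rewrite ?nz ?p0 ?q1 ?q2 [1 + _]addrC natr1 t0.
Qed.

(** * The theorem *)

Theorem theorem5p5 (m n a : nat) (hm : (3 <= m)%N) (hn : (1 <= n)%N)
    (ha : (1 <= a)%N) :
  let M : rat := m%:R in
  let N : rat := n%:R in
  let A : rat := a%:R in
  (num_syt (battery_shape m n a 3))%:R =
    (num_syt (rect_shape m n))%:R *
    mhyp_trunc n
      [:: (fun _ : seq nat => HypRow [:: A; M; - N] [:: - (M * N); 1] 1);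
          (fun ms : seq nat =>
             let t : rat := (nth 0%N ms 0)%:R in
             HypRow [:: A + t; M - 1; - N - 1; - t; - t]
                    [:: - (M * N) + t; - t - 1; - t - 1; 1] 1)]
  /\
  (num_syt (battery_shape m n a 3))%:R =
    (num_syt (rect_shape m n))%:R *
    \sum_(0 <= t < n.+1) \sum_(0 <= v < t.+1)
      (poch A t * poch M t * poch (- N) t
         / (poch (- (M * N)) t * poch 1 t * (t`!)%:R)
       * (poch (A + t%:R) v * poch (M - 1) v * poch (- N - 1) v
            * poch (- t%:R) v ^+ 2
          / (poch (- (M * N) + t%:R) v * poch (- t%:R - 1) v ^+ 2
             * poch 1 v * (v`!)%:R))).
Proof.
move=> M N A.
have second : (num_syt (battery_shape m n a 3))%:R =
    (num_syt (rect_shape m n))%:R *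
    \sum_(0 <= t < n.+1) \sum_(0 <= v < t.+1)
      (poch A t * poch M t * poch (- N) t
         / (poch (- (M * N)) t * poch 1 t * (t`!)%:R)
       * (poch (A + t%:R) v * poch (M - 1) v * poch (- N - 1) v
            * poch (- t%:R) v ^+ 2
          / (poch (- (M * N) + t%:R) v * poch (- t%:R - 1) v ^+ 2
             * poch 1 v * (v`!)%:R))).
  have -> : (num_syt (battery_shape m n a 3))%:R = battery_count m n a 0 0.
    by rewrite battery_cols.
  rewrite battery_count_sum // mulr_sumr.
  apply: eq_big_nat => t /andP[_ tn]; rewrite mulr_sumr.
  (* Beyond [v = t] the counts vanish. *)
  rewrite (big_cat_nat (n := t.+1)) //= [X in _ + X]big_nat [X in _ + X]big1 ?addr0.
    apply: eq_big_nat => v /andP[_ vt].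
    by rewrite summand_eq //; apply/andP.
  by move=> v /andP[tv _]; rewrite battery_count0 ?mulr0.
(* The rows of the series, expanded, are the two factors of the summand. *)
split=> //; rewrite second; congr (_ * _).
rewrite /mhyp_trunc /=; apply: eq_big_nat => t _.
rewrite -mulr_sumr; congr (_ * _).
  rewrite /hyp_term /= !big_cons !big_nil expr1n !mulr1 mul1r.
  by rewrite -[RHS]mulrA -invfM; congr (_ / _); ring.
apply: eq_big_nat => v _.
rewrite /hyp_term /= !big_cons !big_nil expr1n !mulr1 mul1r.
by rewrite -[RHS]mulrA -invfM; congr (_ / _); ring.
Qed.
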